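(* Let $b\in\mathbb{T}$ be fixed. Then the following hold. (i) For every $h$ with $0<h<1$ there is a ray $R_h\subset(1,\infty)$ such that for every $c\in R_h$ we have $W(b,h/c)\subset S(b,h)$. (ii) Let $h>0$. There is some $c>1$ with $ch<1$ such that $S(b,h)\subset W(b,ch)$ if and only if $h<\sqrt{3}/2$. Moreover, if $h<\sqrt{3}/2$, then the set of all constants $c>1$ with $ch<1$ and $S(b,h)\subset W(b,ch)$ is a bounded interval. (iii) Let $h>0$. There is some $c>1$ with $ch<1$ such that $W(b,h/c)\subset S(b,h)\subset W(b,ch)$ if and only if $h<\sqrt{3}/2$. Moreover, if $h<\sqrt{3}/2$, then the set of all constants $c>1$ with $ch<1$ and $W(b,h/c)\subset S(b,h)\subset W(b,ch)$ is a bounded interval.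
   Context: $\mathbb{D}=\{z\in\mathbb{C}:|z|<1\}$ is the open unit disk and $\mathbb{T}=\{z\in\mathbb{C}:|z|=1\}$ is the unit circle. For $b\in\mathbb{T}$ and a parameter $0<r<1$, the Carleson set is $$S(b,r)=\{z\in\mathbb{D}:|z-b|<r\},$$ and the Carleson window is $$W(b,r)=\{z\in\mathbb{D}:|z|>1-r\ \text{and}\ z/|z|\in\overline{S(b,r)}\},$$ where $\overline{S(b,r)}$ is the closure of $S(b,r)$ in $\mathbb{C}$. The parameter of a Carleson set or Carleson window is always required to lie in $(0,1)$. The symbol $\subset$ denotes (not necessarily proper) inclusion. A ray in $(1,\infty)$ is an unbounded interval of the form $[a,\infty)$ or $(a,\infty)$ contained in $(1,\infty)$. *)

(* Defs.v *)
From HB Require Import structures.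
From mathcomp Require Import all_boot all_order all_algebra.
From mathcomp Require Import all_classical all_reals all_analysis.
From mathcomp Require Import complex.
Import Order.TTheory GRing.Theory Num.Theory.
Import numFieldNormedType.Exports.

Set Implicit Arguments.
Unset Strict Implicit.
Unset Printing Implicit Defensive.

Local Open Scope classical_set_scope.
Local Open Scope ring_scope.
Local Open Scope complex_scope.

(* The complex plane is [R[i]]. The norm [`|z|] is an element of [R[i]] with
   zero imaginary part, and [x < y] in [R[i]] means that [y - x] is a positive
   real, so a modulus is compared with a real number [r] through its image
   [r%:C]. The alias [R[i]^o] gives [R[i]] the topology of that norm. *)

Definition unit_disk (R : realType) : set R[i] := [set z | `|z| < 1].

Definition unit_circle (R : realType) : set R[i] := [set z | `|z| = 1].

(* [b] is meant to be on the unit circle and [0 < r < 1]; both are required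
   where the two sets below are used. *)
Definition carleson_set (R : realType) (b : R[i]) (r : R) : set R[i] :=
  [set z | unit_disk z /\ `|z - b| < r%:C].

Definition carleson_window (R : realType) (b : R[i]) (r : R) : set R[i] :=
  [set z | [/\ unit_disk z, (1 - r)%:C < `|z| &
               closure (carleson_set b r : set R[i]^o) (z / `|z|)]].

Definition ray_from_1 (R : realType) (A : set R) : Prop :=
  (exists a : R, A = `[a, +oo[%classic \/ A = `]a, +oo[%classic) /\ A `<=` `]1, +oo[%classic.

Definition bounded_interval (R : realType) (A : set R) : Prop :=
  is_interval A /\ bounded_set A.

(* Main.v *)
Require Import Defs.
From HB Require Import structures.
From mathcomp Require Import all_boot all_order all_algebra.
From mathcomp Require Import all_classical all_reals all_analysis.
From mathcomp Require Import complex.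
From mathcomp Require Import ring lra.
Import Order.TTheory GRing.Theory Num.Theory.
Import numFieldNormedType.Exports.
Import Normc.

Set Implicit Arguments.
Unset Strict Implicit.
Unset Printing Implicit Defensive.

Local Open Scope classical_set_scope.
Local Open Scope ring_scope.

(** Write a point of the disk in polar form [z = rho w], with [|w| = 1]. Since
[|b| = 1], the distance to [b] obeys
  [|rho w - b|^2 = (1 - rho)^2 + rho |w - b|^2]      ([sqr_dist_polar]),
while membership in the window [W(b, r)] decouples into [1 - r < rho < 1] and
[|w - b| <= r] ([carleson_windowP]). Every inclusion thereby becomes a question
about the two real numbers [rho] and [d = |w - b|].

Window inside set: for [0 < r < 1] the supremum of [(1 - rho)^2 + rho d^2] over
the window is its value [r^2 (2 - r)] at the excluded inner corner
[rho = 1 - r], [d = r]. Hence [W(b, r)] lies in [S(b, h)] as soon as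
[r^2 (2 - r) <= h^2] ([carleson_window_sub_set]). For [r = h / c] this holds
whenever [c >= 2], which is (i).

Set inside window: a ray from 0 meets the disk of radius [h] about [b] exactly
when its angle with [b] is less than [arcsin h]. The ray at the limiting angle
is tangent to the circle at the point with [rho = sqrt (1 - h^2)], and its
direction has [d^2 = 2 - 2 sqrt (1 - h^2)]. So [S(b, h)] fits in [W(b, k)], with
[h <= k < 1], when [2 - 2 sqrt (1 - h^2) <= k^2] ([carleson_set_sub_window]).
A [k < 1] with this property exists precisely when the limiting angle is below
60 degrees, that is when [h < sqrt 3 / 2]; the converse direction is
[carleson_set_sub_window_radius_lt].

For (iii), put [k = c h]. As [k] tends to 1 the condition for the first
inclusion becomes [h^2 (2 - h^2) <= 1], and [1 - h^2 (2 - h^2) = (1 - h^2)^2] is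
positive. So both inclusions hold for [k] close enough to 1
([exists_window_constant]), and the threshold of (ii) is unchanged.

The interval claims need no computation: [W(b, r)] grows with [r], so each set of
admissible constants is closed upwards below [1 / h]
([bounded_interval_upward_closed]). *)

Local Open Scope complex_scope.
Section CarlesonGeometry.
Variable R : realType.
Implicit Types (b w z : R[i]) (r h k rho : R).

(** * The real-valued modulus *)

Lemma normCE z : `|z| = (normc z)%:C.
Proof. by case: z => x y; rewrite normc_def. Qed.

Lemma normc_ge0 z : 0 <= normc z.
Proof. by case: z => x y; exact: sqrtr_ge0. Qed.

Lemma sqr_normcE z : normc z ^+ 2 = complex.Re z ^+ 2 + complex.Im z ^+ 2.
Proof. by case: z => x y; rewrite /normc sqr_sqrtr ?addr_ge0 ?sqr_ge0. Qed.

Lemma normc_real rho : 0 <= rho -> normc rho%:C = rho.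
Proof. by move=> r0; rewrite /= expr0n /= addr0 sqrtr_sqr ger0_norm. Qed.

Lemma real_complex_neq0 rho : 0 < rho -> rho%:C != 0.
Proof. by move=> rho0; rewrite (inj_eq (@complexI R)) gt_eqF. Qed.

Lemma normc_normalize z : 0 < normc z -> normc (z / (normc z)%:C) = 1.
Proof.
by move=> z0; rewrite normcM normcV normc_real ?normc_ge0 // divff // gt_eqF.
Qed.

(** The law of cosines, with the cosine of the angle between [w] and [b]
eliminated in favour of the chord [|w - b|]. *)
Lemma sqr_dist_polar b w rho : normc b = 1 -> normc w = 1 ->
  normc (rho%:C * w - b) ^+ 2 = (1 - rho) ^+ 2 + rho * normc (w - b) ^+ 2.
Proof.
move=> hb hw; have := sqr_normcE w; have := sqr_normcE b; rewrite hb hw !sqr_normcE.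
case: b w {hb hw} => [b1 b2] [w1 w2] /= hb hw.
transitivity ((1 - rho) ^+ 2 + rho * ((w1 - b1) ^+ 2 + (w2 - b2) ^+ 2)
    + (rho ^+ 2 - rho) * (w1 ^+ 2 + w2 ^+ 2 - 1 ^+ 2)
    + (1 - rho) * (b1 ^+ 2 + b2 ^+ 2 - 1 ^+ 2)); first by ring.
by rewrite -hb -hw !subrr !mulr0 !addr0.
Qed.

(** * Carleson sets and windows in polar form *)

Lemma carleson_setP b r z :
  carleson_set b r z <-> normc z < 1 /\ normc (z - b) < r.
Proof. by rewrite /carleson_set /unit_disk /= !normCE -(ltcR (normc z)) -ltcR. Qed.

(** For the nontrivial direction, a point [w] of the circle with [|w - b| <= r]
is approached along the segment towards [c = (1 - r / 2) b]. Since [c] lies in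
the open disk and strictly within distance [r] of [b], convexity puts every point
of the segment other than [w] in the Carleson set, even when [w = b] or
[|w - b| = r]. *)
Lemma closure_carleson_set b w r : normc b = 1 -> normc w = 1 -> 0 < r -> r < 1 ->
  closure (carleson_set b r : set R[i]^o) w <-> normc (w - b) <= r.
Proof.
move=> hb hw r0 r1; split.
- move=> cw; rewrite leNgt; apply/negP => rw.
  have e0 : 0 < (normc (w - b) - r)%:C by rewrite ltcR subr_gt0.
  have [z [/carleson_setP [_ zb]]] := cw _ (nbhsx_ballx (w : R[i]^o) _ e0).
  rewrite -ball_normE /= normCE ltcR => wz.
  have := le_normcD (w - z) (z - b); rewrite addrA subrK; lra.
- move=> wb B /nbhs_ballP[e /= e0 eB].
  have [e' ee'] : exists e', e = e'%:C.
    by exists (complex.Re e); rewrite RRe_real // gtr0_real.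
  rewrite {}ee' {e} ltcR in e0 eB.
  (* As [|w - c| <= 2], the point at parameter [t] is within [e' / 2] of [w]. *)
  pose t := Num.min (1 / 2) (e' / 4).
  have t0 : 0 < t by rewrite lt_min; apply/andP; split; lra.
  have t1 : t <= 1 / 2 by rewrite ge_min lexx.
  have te : t <= e' / 4 by rewrite ge_min lexx orbT.
  have [c nc cb] : exists2 c, normc c = 1 - r / 2 & normc (c - b) = r / 2.
    exists ((1 - r / 2)%:C * b).
      by rewrite normcM hb mulr1 normc_real //; lra.
    have -> : (1 - r / 2)%:C * b - b = - ((r / 2)%:C * b).
      by rewrite rmorphB rmorph1; ring.
    by rewrite normcN normcM hb mulr1 normc_real //; lra.
  pose v := (1 - t)%:C * w + t%:C * c.
  exists v; split.
  + apply/carleson_setP; split.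
    * apply: (le_lt_trans (le_normcD _ _)).
      rewrite !normcM nc hw !normc_real; [nra|lra|lra].
    * have -> : v - b = (1 - t)%:C * (w - b) + t%:C * (c - b).
        by rewrite /v rmorphB rmorph1; ring.
      apply: (le_lt_trans (le_normcD _ _)).
      rewrite !normcM cb !normc_real; [nra|lra|lra].
  + apply: eB; rewrite -ball_normE /= normCE ltcR.
    have -> : w - v = t%:C * (w - c) by rewrite /v rmorphB rmorph1; ring.
    rewrite normcM normc_real; last lra.
    have := le_normcD w (- c); rewrite normcN nc hw => wc; nra.
Qed.

(** The polar description of the window: the closure in its definition only
constrains the direction [w], and does so through a closed inequality. *)
Lemma carleson_windowP b r z : normc b = 1 -> 0 < r -> r < 1 ->
  carleson_window b r z <->
  exists rho w, [/\ z = rho%:C * w, normc w = 1, 1 - r < rho, rho < 1 &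
                  normc (w - b) <= r].
Proof.
move=> hb r0 r1; split.
- move=> [z1 rz cz]; rewrite /unit_disk /= normCE in z1 rz cz.
  rewrite -[1]/(1%:C) !ltcR in z1 rz.
  have z0 : 0 < normc z by lra.
  have nw := normc_normalize z0.
  exists (normc z), (z / (normc z)%:C); split => //.
    by rewrite mulrC divfK // real_complex_neq0.
  by apply/closure_carleson_set.
- move=> [rho [w [-> hw rr r1' wb]]].
  have rho0 : 0 < rho by lra.
  have nz : normc (rho%:C * w) = rho by rewrite normcM hw mulr1 normc_real // ltW.
  rewrite /carleson_window /unit_disk /= normCE nz -[1]/(1%:C) !ltcR; split => //.
  rewrite mulrC mulKf ?real_complex_neq0 //.
  by apply/closure_carleson_set.
Qed.

Lemma sub_carleson_window b r k : r <= k ->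
  carleson_window b r `<=` carleson_window b k.
Proof.
move=> rk z [z1 rz cz]; split => //.
  by apply: le_lt_trans rz; rewrite lecR; lra.
apply: closureS cz => u /carleson_setP [u1 ub]; apply/carleson_setP; split => //.
lra.
Qed.

(** * Criteria for the inclusions *)

(** The right-hand side bounds [(1 - rho)^2 + rho d^2] because
[r^2 (2 - r) - (1 - rho)^2 - rho r^2 = (r - t) (r + t - r^2)] with
[t = 1 - rho], and [0 < t < r < 1] on the window. *)
Lemma carleson_window_sub_set b r h : normc b = 1 -> 0 < r -> r < 1 -> 0 < h ->
  r ^+ 2 * (2 - r) <= h ^+ 2 -> carleson_window b r `<=` carleson_set b h.
Proof.
move=> hb r0 r1 h0 rh z /carleson_windowP -/(_ hb r0 r1) [rho [w [-> hw rr r1' wb]]].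
apply/carleson_setP; split.
  by rewrite normcM hw mulr1 normc_real; lra.
rewrite -(@ltr_pXn2r _ 2) ?nnegrE ?normc_ge0 ?(ltW h0) // sqr_dist_polar //.
have := normc_ge0 (w - b); set d := normc _ in wb * => d0.
have d2 : d ^+ 2 <= r ^+ 2 by rewrite ler_pXn2r ?nnegrE // ltW.
have : rho * d ^+ 2 <= rho * r ^+ 2 by rewrite ler_wpM2l //; lra.
suff : 0 < (r - (1 - rho)) * (r + (1 - rho) - r ^+ 2) by nra.
by apply: mulr_gt0; nra.
Qed.

(** Tangency, in algebraic form: with [s = sqrt (1 - h^2)], the inequality
[(1 - rho)^2 + rho d^2 < h^2] gives [rho d^2 < 2 rho - (rho^2 + s^2)], and
[rho^2 + s^2 >= 2 rho s] by the arithmetic-geometric mean inequality. *)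
Lemma carleson_set_sub_window b h k : normc b = 1 -> 0 < h -> h <= k -> k < 1 ->
  2 - 2 * Num.sqrt (1 - h ^+ 2) <= k ^+ 2 ->
  carleson_set b h `<=` carleson_window b k.
Proof.
move=> hb h0 hk k1; set s := Num.sqrt _ => sk z /carleson_setP [z1 zb].
have s2 : s ^+ 2 = 1 - h ^+ 2 by rewrite sqr_sqrtr //; nra.
have := le_normcD (b - z) z; rewrite subrK hb -normcN opprB => zh.
have rho0 : 0 < normc z by lra.
have [w nw zE] : exists2 w, normc w = 1 & z = (normc z)%:C * w.
  exists (z / (normc z)%:C); first exact: normc_normalize.
  by rewrite mulrC divfK // real_complex_neq0.
move: (normc z) z1 zh rho0 zE => rho z1 zh rho0 zE.
apply/carleson_windowP; [exact: hb|lra|lra|exists rho, w; split => //; first lra].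
have k0 : 0 <= k by lra.
rewrite -(@ler_pXn2r _ 2) ?nnegrE ?normc_ge0 //.
move: zb; rewrite -(@ltr_pXn2r _ 2) ?nnegrE ?normc_ge0 ?(ltW h0) // zE sqr_dist_polar //.
move=> zb; apply: le_trans sk.
rewrite -(ler_pM2l rho0); have := sqr_ge0 (rho - s); nra.
Qed.

(** If [h >= sqrt 3 / 2], the limiting angle is at least 60 degrees, so [S(b, h)]
contains points whose direction is at any distance less than 1 from [b], and
some of these are at distance more than [k]. *)
Lemma carleson_set_sub_window_radius_lt b h k : normc b = 1 -> 0 < h -> h < k -> k < 1 ->
  carleson_set b h `<=` carleson_window b k -> h < Num.sqrt 3 / 2.
Proof.
move=> hb h0 hk k1 sub; rewrite ltNge; apply/negP => h3.
have s0 : 0 <= Num.sqrt 3 :> R := sqrtr_ge0 _.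
have s2 : Num.sqrt 3 ^+ 2 = 3 :> R by rewrite sqr_sqrtr.
have h2 : 3 / 4 <= h ^+ 2 by nra.
(* [x] is the cosine of the angle of the witness [x u b] with [b]. A direction of
   cosine [x] has [|w - b|^2 = 2 - 2 x], here the midpoint of [k^2] and 1. The
   modulus [x] makes the witness the point of its ray closest to [b]. *)
pose x := (3 - k ^+ 2) / 4.
have x1 : 1 / 2 < x by rewrite /x; nra.
have x2 : x < 3 / 4 by rewrite /x; nra.
pose u : R[i] := Complex x (Num.sqrt (1 - x ^+ 2)).
have y2 : Num.sqrt (1 - x ^+ 2) ^+ 2 = 1 - x ^+ 2 by rewrite sqr_sqrtr //; nra.
have nu : normc u = 1 by rewrite /normc /u y2 addrC subrK sqrtr1.
have nw : normc (u * b) = 1 by rewrite normcM nu hb mulr1.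
have dw : normc (u * b - b) ^+ 2 = 2 - 2 * x.
  rewrite -{2}[b]mul1r -mulrBl normcM hb mulr1 sqr_normcE /= subr0 y2; ring.
have x0 : 0 <= x by lra.
have : carleson_set b h (x%:C * (u * b)).
  apply/carleson_setP; split.
    rewrite normcM nw mulr1 normc_real //; lra.
  rewrite -(@ltr_pXn2r _ 2) ?nnegrE ?normc_ge0 ?(ltW h0) // sqr_dist_polar // dw; nra.
move=> /sub /carleson_windowP -/(_ hb) [|//|rho [w [zE hw rr r1 wb]]]; first lra.
have xr : x = rho.
  have /(congr1 (@normc R)) := zE; rewrite !normcM hw nu hb !mulr1 !normc_real //; lra.
have xC : x%:C != 0 by apply: real_complex_neq0; lra.
move: zE; rewrite -xr => /(mulfI xC) wE.
have : normc (w - b) ^+ 2 <= k ^+ 2 by rewrite ler_pXn2r ?nnegrE ?normc_ge0 //; lra.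
rewrite -wE dw /x; nra.
Qed.

(** With [k = c h], so that [h / c = h^2 / k], the two inclusion criteria follow
from the lower bounds [2 - 2 sqrt (1 - h^2)] and [h^2 (2 - h^2)] on [k^2]. Both are
less than 1 when [h < sqrt 3 / 2], which leaves room for [k < 1]. *)
Lemma exists_window_constant b h : normc b = 1 -> 0 < h -> h < Num.sqrt 3 / 2 ->
  exists c, [/\ 1 < c, c * h < 1, carleson_window b (h / c) `<=` carleson_set b h &
            carleson_set b h `<=` carleson_window b (c * h)].
Proof.
move=> hb h0 h3.
have s30 : 0 <= Num.sqrt 3 :> R := sqrtr_ge0 _.
have s32 : Num.sqrt 3 ^+ 2 = 3 :> R by rewrite sqr_sqrtr.
have h2 : h ^+ 2 < 3 / 4 by nra.
have h1 : h < 1 by nra.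
pose s := Num.sqrt (1 - h ^+ 2).
have s2 : s ^+ 2 = 1 - h ^+ 2 by rewrite sqr_sqrtr //; lra.
have s0 : 0 <= s := sqrtr_ge0 _.
have s1 : 1 / 2 < s by nra.
pose m := Num.max (2 - 2 * s) (h ^+ 2 * (2 - h ^+ 2)).
have ms : 2 - 2 * s <= m by rewrite le_max lexx.
(* This bound serves twice: [k < 1] gives [h^2 / k >= h^2], which yields the
   criterion for the window of radius [h^2 / k], and as [h < 1] it forces [h < k]. *)
have mh : h ^+ 2 * (2 - h ^+ 2) <= m by rewrite le_max lexx orbT.
have m1 : m < 1 by rewrite gt_max; apply/andP; split; nra.
(* Then [k^2 >= m] because [k^2 - m = ((1 - m) / 2)^2]. *)
pose k := (1 + m) / 2.
have mk : m <= k ^+ 2 by have := sqr_ge0 (1 - m); rewrite /k; nra.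
have k1 : k < 1 by rewrite /k; lra.
have k0 : 0 < k by rewrite /k; nra.
have hk : h < k by rewrite -(@ltr_pXn2r _ 2) ?nnegrE ?ltW //; nra.
exists (k / h); rewrite divfK ?gt_eqF //; split => //.
- by rewrite ltr_pdivlMr // mul1r.
- rewrite invf_div mulrA -expr2.
  have r0 : 0 < h ^+ 2 / k by rewrite divr_gt0 // exprn_gt0.
  have rE : h ^+ 2 / k * k = h ^+ 2 by rewrite divfK // gt_eqF.
  apply: carleson_window_sub_set => //; first by rewrite ltr_pdivrMr // mul1r; nra.
  move: r0 rE; set r := _ / k => r0 rE.
  have hr : h ^+ 2 <= r by rewrite -rE; nra.
  have k2 : 0 < k ^+ 2 by rewrite exprn_gt0.
  rewrite -(ler_pM2l k2) mulrA -exprMn [k * r]mulrC rE; nra.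
- by apply: carleson_set_sub_window => //; [exact: ltW|exact: le_trans mk].
Qed.

(** * The sets of admissible constants *)

Lemma bounded_interval_upward_closed (A : set R) h : 0 < h ->
  (forall c, A c -> 1 < c /\ c * h < 1) ->
  (forall c c', A c -> c <= c' -> c' * h < 1 -> A c') ->
  bounded_interval A.
Proof.
move=> h0 Ab Aup; split.
  move=> x y Ax Ay z /andP[xz zy]; apply: Aup Ax xz _.
  by have [_] := Ab _ Ay; nra.
exists h^-1; split; first by rewrite num_real.
move=> M hM c /Ab [c1 ch] /=; rewrite ger0_norm; last lra.
by apply: le_trans (ltW hM); rewrite -[h^-1]mul1r ler_pdivlMr // ltW.
Qed.

End CarlesonGeometry.
Local Close Scope complex_scope.

Theorem theorem2p1 (R : realType) (b : R[i]) (hb : unit_circle b) :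
  [/\ (forall h : R, 0 < h -> h < 1 ->
        exists R_h : set R, ray_from_1 R_h /\
          forall c : R, R_h c ->
            carleson_window b (h / c) `<=` carleson_set b h),
      (forall h : R, 0 < h ->
        ((exists c : R, [/\ 1 < c, c * h < 1 &
            carleson_set b h `<=` carleson_window b (c * h)])
          <-> h < Num.sqrt 3 / 2) /\
        (h < Num.sqrt 3 / 2 ->
          bounded_interval [set c : R | [/\ 1 < c, c * h < 1 &
            carleson_set b h `<=` carleson_window b (c * h)]])) &
      (forall h : R, 0 < h ->
        ((exists c : R, [/\ 1 < c, c * h < 1,
            carleson_window b (h / c) `<=` carleson_set b h &
            carleson_set b h `<=` carleson_window b (c * h)])
          <-> h < Num.sqrt 3 / 2) /\
        (h < Num.sqrt 3 / 2 ->
          bounded_interval [set c : R | [/\ 1 < c, c * h < 1,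
            carleson_window b (h / c) `<=` carleson_set b h &
            carleson_set b h `<=` carleson_window b (c * h)]]))].
Proof.
have nb : normc b = 1 by move: hb; rewrite /unit_circle /= normCE => -[].
split.
- move=> h h0 h1; exists `[2, +oo[%classic; split.
    split; first by exists 2; left.
    by move=> c /=; rewrite !in_itv /= !andbT; lra.
  move=> c /=; rewrite in_itv /= andbT => c2.
  have r0 : 0 < h / c by rewrite divr_gt0 //; lra.
  have rE : h / c * c = h by rewrite divfK // gt_eqF //; lra.
  move: r0 rE; set r := h / c => r0 rE.
  have rh : 2 * r <= h by nra.
  have r2 : (2 * r) ^+ 2 <= h ^+ 2 by rewrite ler_pXn2r ?nnegrE //; lra.
  have r3 : 0 <= r ^+ 2 * r by rewrite mulr_ge0 ?sqr_ge0 // ltW.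
  apply: carleson_window_sub_set => //; nra.
- move=> h h0; split; first split.
  + move=> [c [c1 ch sub]]; have hc : h < c * h by rewrite ltr_pMl.
    exact: carleson_set_sub_window_radius_lt nb h0 hc ch sub.
  + by move=> /(exists_window_constant nb h0) [c [c1 ch _ sub]]; exists c.
  + move=> _; apply: (bounded_interval_upward_closed h0) => [c [c1 ch _] //|].
    move=> c c' [c1 ch sub] cc ch'; split => //; first lra.
    by apply: subset_trans sub _; apply: sub_carleson_window; rewrite // ler_pM2r.
- move=> h h0; split; first split.
  + move=> [c [c1 ch _ sub]]; have hc : h < c * h by rewrite ltr_pMl.
    exact: carleson_set_sub_window_radius_lt nb h0 hc ch sub.
  + exact: exists_window_constant.
  + move=> _; apply: (bounded_interval_upward_closed h0) => [c [c1 ch _ _] //|].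
    move=> c c' [c1 ch sub1 sub2] cc ch'; split => //; first lra.
      apply: subset_trans sub1; apply: sub_carleson_window => //.
      by rewrite ler_pM2l // lef_pV2 // posrE; apply: (lt_trans ltr01); lra.
    by apply: subset_trans sub2 _; apply: sub_carleson_window; rewrite // ler_pM2r.
Qed.
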